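(* Every Hausdorff topological group is (up to algebraic and topological isomorphism) a distributive subgroup of some group of invertible binary operations. That is, for every Hausdorff topological group $G$ there exist a Hausdorff topological space $X$, a distributive subgroup $D\subset H_2(X)$, and a group isomorphism $G\to D$ which is also a homeomorphism, where $D$ carries the subspace topology from $H_2(X)$.
   Context: A continuous binary operation on a topological space $X$ is a continuous map $f:X^2=X\times X\to X$. The composition of two continuous binary operations $f,\varphi$ is $(f\circ\varphi)(t,x)=f(t,\varphi(t,x))$. With this composition the set $C_2(X)$ of all continuous binary operations on $X$ is a monoid with identity element $e(t,x)=x$. An element $f\in C_2(X)$ is invertible if there exists $f^{-1}\in C_2(X)$ with $f\circ f^{-1}=f^{-1}\circ f=e$. $H_2(X)$ is the group of all invertible elements of $C_2(X)$, with the compact-open topology (as a subspace of the space $C(X^2,X)$ of continuous maps $X^2\to X$). A subgroup $D\subset H_2(X)$ is called distributive if $$g(h(x,x'),h(x,x''))=h(x,g(x',x''))$$ for all $x,x',x''\in X$ and all $g,h\in D$. *)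

(* Defs.v *)
From HB Require Import structures.
From mathcomp Require Import all_boot all_classical.
From mathcomp Require Import topology_structure initial_topology.
From mathcomp Require Import product_topology subtype_topology separation_axioms.
From mathcomp Require Import function_spaces.

Set Implicit Arguments.
Unset Strict Implicit.
Unset Printing Implicit Defensive.

Local Open Scope classical_set_scope.
Local Open Scope group_scope.

(* Multiplicative analogue of [topologicalZmodType]; separation is not assumed. *)
HB.mixin Record isTopologicalGroup G of Topological G & Group G := {
  mulg_continuous : continuous (fun x : G * G => x.1 * x.2) ;
  invg_continuous : continuous (fun x : G => x^-1)
}.

#[short(type="topologicalGroupType")]
HB.structure Definition TopologicalGroup :=
  {G of isTopologicalGroup G & Topological G & Group G}.

Definition C2 (X : topologicalType) : Type := continuousType (X * X)%type X.

Section BinaryOperations.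
Context {X : topologicalType}.

HB.instance Definition _ := Choice.copy (C2 X) (continuousType (X * X)%type X).

Definition binop (f : C2 X) (t x : X) : X :=
  (f : continuousType (X * X)%type X) (t, x).

(* The topology induced by the inclusion into the compact-open topology, which
   the library puts on the type of all, possibly discontinuous, functions. *)
HB.instance Definition _ := Topological.copy (C2 X)
  (@initial_topology (C2 X) {compact-open, (X * X)%type -> X}
    (fun f => (f : continuousType (X * X)%type X))).

Lemma binop_continuous (f : C2 X) : continuous (fun p => binop f p.1 p.2).
Proof.
have -> : (fun p => binop f p.1 p.2) = (f : continuousType (X * X)%type X).
  by apply/funext => -[].
exact: cts_fun.
Qed.

Lemma binopP (f g : C2 X) : (forall t x, binop f t x = binop g t x) -> f = g.
Proof. by move=> fg; apply/continuousEP => -[t x]; exact: fg. Qed.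

Lemma binop_comp_continuous (f g : C2 X) :
  continuous (fun p : X * X => binop f p.1 (binop g p.1 p.2)).
Proof.
move=> p; apply: (@continuous_comp _ _ _
  (fun p : X * X => (p.1, binop g p.1 p.2)) (fun p => binop f p.1 p.2)).
  by apply: cvg_pair => /=; [exact: cvg_fst | exact: binop_continuous].
exact: binop_continuous.
Qed.

Definition binop_comp (f g : C2 X) : C2 X :=
  mkcts (@binop_comp_continuous f g) : continuousType (X * X)%type X.

Lemma binop_id_continuous : continuous (fun p : X * X => p.2).
Proof. by move=> p; exact: cvg_snd. Qed.

Definition binop_id : C2 X :=
  mkcts binop_id_continuous : continuousType (X * X)%type X.

Lemma binop_compA : associative binop_comp.
Proof. by move=> f g h; exact: binopP. Qed.

Lemma binop_comp1l : left_id binop_id binop_comp.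
Proof. by move=> f; exact: binopP. Qed.

Lemma binop_comp1r : right_id binop_id binop_comp.
Proof. by move=> f; exact: binopP. Qed.

HB.instance Definition _ :=
  isMonoid.Build (C2 X) binop_compA binop_comp1l binop_comp1r.

Definition invertible_binop : set (C2 X) :=
  [set f | exists g : C2 X, f * g = 1 /\ g * f = 1].

End BinaryOperations.

(* [set_type] carries the subspace topology. *)
Definition H2 (X : topologicalType) : Type := set_type (@invertible_binop X).

Section InvertibleBinaryOperations.
Context {X : topologicalType}.

HB.instance Definition _ := SubChoice.copy (H2 X) (set_type (@invertible_binop X)).
HB.instance Definition _ := Topological.copy (H2 X) (set_type (@invertible_binop X)).

Definition mkH2 (f : C2 X) (f_inv : invertible_binop f) : H2 X :=
  exist _ f (mem_set f_inv).

Lemma H2P (f : H2 X) : exists g : C2 X, val f * g = 1 /\ g * val f = 1.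
Proof. exact: set_mem (valP f). Qed.

Lemma H2_mul_subproof (f g : H2 X) : invertible_binop (val f * val g).
Proof.
have [f' [ff' f'f]] := H2P f; have [g' [gg' g'g]] := H2P g.
exists (g' * f'); split.
  by rewrite mulgA -(mulgA _ _ g') gg' mulg1.
by rewrite mulgA -(mulgA _ _ (val f)) f'f mulg1.
Qed.

Definition H2_mul (f g : H2 X) : H2 X := mkH2 (H2_mul_subproof f g).

Lemma H2_one_subproof : invertible_binop (1 : C2 X).
Proof. by exists 1; rewrite mulg1. Qed.

Definition H2_one : H2 X := mkH2 H2_one_subproof.

Lemma H2_inv_subproof (f : H2 X) : invertible_binop (projT1 (cid (H2P f))).
Proof. by case: (cid (H2P f)) => g [fg gf]; exists (val f). Qed.

Definition H2_inv (f : H2 X) : H2 X := mkH2 (H2_inv_subproof f).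

Lemma H2_mulA : associative H2_mul.
Proof. by move=> f g h; apply: val_inj; exact: mulgA. Qed.

Lemma H2_mul1l : left_id H2_one H2_mul.
Proof. by move=> f; apply: val_inj; exact: mul1g. Qed.

Lemma H2_mul1r : right_id H2_one H2_mul.
Proof. by move=> f; apply: val_inj; exact: mulg1. Qed.

Lemma H2_mulVl : left_inverse H2_one H2_inv H2_mul.
Proof. by move=> f; apply: val_inj => /=; case: (cid (H2P f)) => g []. Qed.

Lemma H2_mulVr : right_inverse H2_one H2_inv H2_mul.
Proof. by move=> f; apply: val_inj => /=; case: (cid (H2P f)) => g []. Qed.

HB.instance Definition _ :=
  isGroup.Build (H2 X) H2_mulA H2_mul1l H2_mul1r H2_mulVl H2_mulVr.

Definition subgroup (D : set (H2 X)) : Prop := group_closed (mem D).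

Definition distributive_subgroup (D : set (H2 X)) : Prop :=
  subgroup D /\
  forall g h : H2 X, D g -> D h -> forall x x' x'' : X,
    binop (val g) (binop (val h) x x') (binop (val h) x x'') =
    binop (val h) x (binop (val g) x' x'').

End InvertibleBinaryOperations.

(* Main.v *)
Require Import Defs.
From HB Require Import structures.
From mathcomp Require Import all_boot all_classical.
From mathcomp Require Import topology_structure initial_topology.
From mathcomp Require Import product_topology subtype_topology separation_axioms.
From mathcomp Require Import function_spaces.
From mathcomp Require Import compact.

Set Implicit Arguments.
Unset Strict Implicit.
Unset Printing Implicit Defensive.

Local Open Scope classical_set_scope.
Local Open Scope group_scope.

(** Let [G] act on itself by [g(x, y) = x g x^-1 y].  For fixed [x] this is left
    translation by the conjugate [x g x^-1], so [g |-> g(-, -)] is a homomorphism,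
    and both sides of the distributive law reduce to [x h x^-1 x' g x'^-1 x''].
    Since [g = g(1, 1)], the inverse map is an evaluation, which is continuous
    for the compact-open topology; the direct map is continuous because it
    curries the jointly continuous map [(g, (x, y)) |-> g(x, y)]. *)

Section TopologicalGroupContinuity.
Context {T : topologicalType} {G : topologicalGroupType}.

Lemma continuousMg (f g : T -> G) :
  continuous f -> continuous g -> continuous (fun x => f x * g x).
Proof.
move=> cf cg x; apply: (@continuous_comp _ _ _
  (fun x => (f x, g x)) (fun p : G * G => p.1 * p.2)).
  by apply: cvg_pair; [exact: cf | exact: cg].
exact: mulg_continuous.
Qed.

Lemma continuousVg (f : T -> G) :
  continuous f -> continuous (fun x => (f x)^-1).
Proof.
move=> cf x; apply: (@continuous_comp _ _ _ f (fun y : G => y^-1)).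
  exact: cf.
exact: invg_continuous.
Qed.

End TopologicalGroupContinuity.

Section BinaryOperationTopology.
Context {X : topologicalType}.

Lemma binop_eval_continuous (t x : X) :
  continuous (fun f : C2 X => binop f t x).
Proof.
apply/continuousP => O oO.
(* A point is compact, so the preimage of [O] under evaluation is the trace on [C2 X] of a subbasic
   open set. *)
exists [set u : {compact-open, (X * X)%type -> X} | u @` [set (t, x)] `<=` O].
  by apply: compact_open_open => //; exact: compact_set1.
apply/seteqP; split=> f /=; first by apply; exists (t, x).
by move=> Ofx _ [_ -> <-].
Qed.

(** The topology of [C2 X] is initial for its inclusion into the space of all functions, so it
    suffices to compose [F] with that inclusion, which gives a curried map. *)
Lemma continuous_to_C2 (T : topologicalType) (F : T -> C2 X) :
  continuous (fun p : T * (X * X) => binop (F p.1) p.2.1 p.2.2) -> continuous F.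
Proof.
move=> cF; apply: continuous_comp_initial.
rewrite (_ : _ \o F = curry (fun p => binop (F p.1) p.2.1 p.2.2)).
  exact: continuous_curry_fun.
by apply/funext => u; apply/funext => -[].
Qed.

End BinaryOperationTopology.

Section ConjugateTranslation.
Context {G : topologicalGroupType}.

Lemma conj_translation_joint_continuous :
  continuous (fun p : G * (G * G) => p.2.1 * p.1 * p.2.1^-1 * p.2.2).
Proof.
have c1 : continuous (fun p : G * (G * G) => p.1) by move=> p; exact: cvg_fst.
have c2 : continuous (fun p : G * (G * G) => p.2) by move=> p; exact: cvg_snd.
have c21 : continuous (fun p : G * (G * G) => p.2.1).
  move=> p; apply: (@continuous_comp _ _ _ snd fst); first exact: c2.
  exact: cvg_fst.
have c22 : continuous (fun p : G * (G * G) => p.2.2).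
  move=> p; apply: (@continuous_comp _ _ _ snd snd); first exact: c2.
  exact: cvg_snd.
apply: continuousMg => //; apply: continuousMg; last exact: continuousVg.
exact: continuousMg.
Qed.

Lemma conj_translation_continuous (g : G) :
  continuous (fun p : G * G => p.1 * g * p.1^-1 * p.2).
Proof.
(* The second half of [continuous_curry] is the continuity of each section at a fixed first
   coordinate. *)
by have [_ /(_ g)] := continuous_curry conj_translation_joint_continuous.
Qed.

Definition conj_translation (g : G) : C2 G :=
  mkcts (@conj_translation_continuous g) : continuousType (G * G)%type G.

Lemma conj_translationE (g x y : G) :
  binop (conj_translation g) x y = x * g * x^-1 * y.
Proof. by []. Qed.

Lemma conj_translationM : {morph conj_translation : g h / g * h}.
Proof.
move=> g h; apply: binopP => t x.
(* The product of [C2 G] is composition in the second variable, so this holds by conversion; then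
   the inner [t^-1 * t] cancels. *)
rewrite [RHS](_ : _ = binop (conj_translation g) t
  (binop (conj_translation h) t x)) //.
by rewrite !conj_translationE !mulgA mulgVK.
Qed.

Lemma conj_translation1 : conj_translation 1 = 1.
Proof.
by apply: binopP => t x; rewrite conj_translationE mulg1 mulgV mul1g.
Qed.

Lemma conj_translation_invertible (g : G) :
  invertible_binop (conj_translation g).
Proof.
exists (conj_translation g^-1).
by rewrite -!conj_translationM mulgV mulVg conj_translation1.
Qed.

Definition conj_translationH (g : G) : H2 G :=
  mkH2 (conj_translation_invertible g).

Lemma conj_translationHM : {morph conj_translationH : g h / g * h}.
Proof. by move=> g h; apply: val_inj; exact: conj_translationM. Qed.

Lemma conj_translationH1 : conj_translationH 1 = 1.
Proof. by apply: val_inj; exact: conj_translation1. Qed.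

(** The inverse in [H2 G] is picked by [cid] and does not compute, so it is identified by
    cancellation. *)
Lemma conj_translationHV : {morph conj_translationH : g / g^-1}.
Proof.
move=> g; apply: (@mulgI _ (conj_translationH g)).
by rewrite -conj_translationHM !mulgV conj_translationH1.
Qed.

Lemma conj_translationH_distributive :
  distributive_subgroup (range conj_translationH).
Proof.
split; first split.
- by rewrite inE; exists 1 => //; exact: conj_translationH1.
- move=> _ _ /[!inE] -[g _ <-] [h _ <-]; exists (g / h) => //.
  by rewrite conj_translationHM conj_translationHV.
- move=> _ _ [g _ <-] [h _ <-] x x' x''; rewrite !conj_translationE.
  (* With [u = x * h * x^-1], the left side is [u x' g x'^-1 u^-1 u x''], where [u^-1 u] cancels. *)
  by rewrite !invgM !invgK !mulgA !mulgVK mulgK.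
Qed.

Lemma conj_translation_eval1 (g : G) : binop (conj_translation g) 1 1 = g.
Proof. by rewrite conj_translationE invg1 mul1g !mulg1. Qed.

End ConjugateTranslation.

Theorem theorem8 (G : topologicalGroupType) (hG : hausdorff_space G) :
  exists (X : topologicalType) (D : set (H2 X)),
    [/\ hausdorff_space X,
        distributive_subgroup D &
        exists (phi : G -> set_type D) (psi : set_type D -> G),
          [/\ cancel phi psi, cancel psi phi,
              {morph (fun g => val (phi g)) : g h / g * h},
              continuous phi & continuous psi]].
Proof.
exists G, (range conj_translationH); split=> //.
  exact: conj_translationH_distributive.
have phiP g : range (@conj_translationH G) (conj_translationH g) by exists g.
pose phi g : set_type (range (@conj_translationH G)) :=
  SigSub (mem_set (phiP g)).
pose psi (d : set_type (range (@conj_translationH G))) : G :=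
  binop (val (val d)) 1 1.
have phiK : cancel phi psi by move=> g; exact: conj_translation_eval1.
exists phi, psi; split=> //.
(* Surjectivity of [phi] onto the range makes its left inverse two-sided. *)
- move=> d; have [g _ gd] := set_mem (valP d).
  have -> : d = phi g by apply: val_inj; rewrite -gd.
  by rewrite phiK.
- exact: conj_translationHM.
(* Two nested subspace topologies are peeled off: the range inside [H2 G], then [H2 G] inside
   [C2 G]. *)
- apply: continuous_comp_initial; apply: continuous_comp_initial.
  apply: continuous_to_C2.
  exact: conj_translation_joint_continuous.
- have cval : continuous (fun d : set_type (range (@conj_translationH G)) =>
      val (val d) : C2 G).
    move=> d; apply: (@continuous_comp
      (set_type (range (@conj_translationH G))) (H2 G) (C2 G) set_val set_val);
      exact: initial_continuous.
  move=> d; exact: (continuous_comp (cval d) (@binop_eval_continuous G 1 1 _)).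
Qed.
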